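(* Let $G$ be a finite simple graph and $T$ an automorphism of $G$. Then the Lefschetz zeta function $\zeta_T(z)$ of $T$ is the rational function $$ \zeta_T(z) = \prod_{p=1}^{\infty} (1-z^p)^{a(p)-b(p)}\,(1+z^p)^{c(p)-d(p)}, $$ where $a(p)$, respectively $c(p)$, is the number of odd-dimensional prime periodic orbits $\{x,Tx,\dots,T^{p-1}x\}$ of simplices of minimal period $p$ for which $T^p|x$ has positive, respectively negative, signature, and $b(p)$, respectively $d(p)$, is the number of even-dimensional prime periodic orbits of simplices of minimal period $p$ for which $T^p|x$ has positive, respectively negative, signature.
   Context: For a finite simple graph $G=(V,E)$, a $k$-simplex is a complete subgraph $K_{k+1}$ of $G$ (identified with its vertex set), of dimension $k\ge 0$. An automorphism $T$ of $G$ acts on the set of simplices. A prime periodic orbit of minimal period $p$ is a set $\{x,Tx,\dots,T^{p-1}x\}$ of $p$ distinct simplices with $T^p x=x$ (as a set of vertices); its dimension is the common dimension of its simplices. $T^p|x$ is the permutation that $T^p$ induces on the vertices of $x$. Only finitely many $p$ occur as minimal periods, so the product is finite. A $k$-form is a real-valued function $f(x_0,\dots,x_k)$ on ordered $k$-simplices that is antisymmetric in its $k+1$ arguments. The exterior derivative is $df(x_0,\dots,x_{k+1})=\sum_i (-1)^i f(x_0,\dots,\hat{x_i},\dots,x_{k+1})$. The cohomology group $H^k(G)$ is the real vector space of closed $k$-forms ($df=0$) modulo exact $k$-forms ($f=dg$). An automorphism $T$ induces by pull-back $f\mapsto f(T(\cdot),\dots,T(\cdot))$ a linear map $T_k$ on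 $H^k(G)$, and the Lefschetz number is $L(T)=\sum_{k\ge0}(-1)^k\mathrm{tr}(T_k)$. The Lefschetz zeta function of $T$ is $\zeta_T(z)=\exp\left(\sum_{n=1}^\infty L(T^n)\frac{z^n}{n}\right)$, viewed as a formal power series (or as an analytic function near $z=0$). *)

(* Defs.v *)
From HB Require Import structures.
From mathcomp Require Import all_boot all_order all_algebra all_fingroup.
From mathcomp Require Import generic_quotient ring_quotient.
From mathcomp Require Import boolp reals.

Set Implicit Arguments.
Unset Strict Implicit.
Unset Printing Implicit Defensive.

Import Order.TTheory GRing.Theory Num.Theory.
Import Quotient.

Local Open Scope ring_scope.
Local Open Scope quotient_scope.

(* A wrapper around [nat -> R], so that the Cauchy product defined below is not
   confused with the pointwise product of functions. *)
Record fps (R : Type) := Fps { fps_coef : nat -> R }.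
Arguments Fps {R}.
Arguments fps_coef {R}.

HB.instance Definition _ (R : Type) := [isNew for @fps_coef R].
HB.instance Definition _ (R : choiceType) := [Choice of fps R by <:].

Lemma fpsP (R : Type) (f g : fps R) : fps_coef f =1 fps_coef g -> f = g.
Proof. by move=> fg; apply: (@val_inj _ _ (fps R)); apply/funext. Qed.

Section FpsRing.
Variable R : comUnitRingType.
Implicit Types f g h : fps R.

Definition fps_zero : fps R := Fps (fun=> 0).
Definition fps_opp f : fps R := Fps (fun n => - fps_coef f n).
Definition fps_add f g : fps R := Fps (fun n => fps_coef f n + fps_coef g n).
Definition fps_of_poly (p : {poly R}) : fps R := Fps (fun n => p`_n).
Definition fps_one : fps R := fps_of_poly 1.
Definition fps_mul f g : fps R :=
  Fps (fun n => \sum_(i < n.+1) fps_coef f i * fps_coef g (n - i)).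

Fact fps_addA : associative fps_add.
Proof. by move=> f g h; apply/fpsP => n /=; rewrite addrA. Qed.
Fact fps_addC : commutative fps_add.
Proof. by move=> f g; apply/fpsP => n /=; rewrite addrC. Qed.
Fact fps_add0 : left_id fps_zero fps_add.
Proof. by move=> f; apply/fpsP => n /=; rewrite add0r. Qed.
Fact fps_addN : left_inverse fps_zero fps_opp fps_add.
Proof. by move=> f; apply/fpsP => n /=; rewrite addNr. Qed.

HB.instance Definition _ :=
  GRing.isZmodule.Build (fps R) fps_addA fps_addC fps_add0 fps_addN.

Definition fps_trunc m f : {poly R} := \poly_(i < m) fps_coef f i.

Lemma coef_fps_trunc m f i :
  (fps_trunc m f)`_i = if (i < m)%N then fps_coef f i else 0.
Proof. by rewrite coef_poly. Qed.

Lemma fps_mulE f g n m : (n < m)%N ->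
  fps_coef (fps_mul f g) n = (fps_trunc m f * fps_trunc m g)`_n.
Proof.
move=> nm; rewrite coefM /=; apply: eq_bigr => i _; rewrite !coef_fps_trunc.
by rewrite (leq_ltn_trans _ nm) ?leq_ord // (leq_ltn_trans _ nm) // leq_subr.
Qed.

Fact fps_mulA : associative fps_mul.
Proof.
move=> f g h; apply/fpsP => n.
transitivity (fps_trunc n.+1 f * fps_trunc n.+1 g * fps_trunc n.+1 h)`_n.
  rewrite -mulrA coefM /=; apply: eq_bigr => i _; rewrite coef_fps_trunc ltn_ord.
  by rewrite -fps_mulE // ltnS leq_subr.
rewrite coefM /=; apply: eq_bigr => i _; rewrite coef_fps_trunc ltnS leq_subr.
by rewrite -fps_mulE.
Qed.

Fact fps_mulC : commutative fps_mul.
Proof. by move=> f g; apply/fpsP => n; rewrite !(@fps_mulE _ _ n n.+1) // mulrC. Qed.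

Fact fps_mul1 : left_id fps_one fps_mul.
Proof.
move=> f; apply/fpsP => n /=; rewrite big_ord_recl /= coef1 mul1r subn0.
by rewrite big1 ?addr0 // => i _; rewrite coef1 mul0r.
Qed.

Fact fps_mulDl : left_distributive fps_mul +%R.
Proof.
move=> f g h; apply/fpsP => n /=; rewrite -big_split /=.
by apply: eq_bigr => i _; rewrite mulrDl.
Qed.

Fact fps_one_neq0 : fps_one != 0.
Proof.
apply/eqP => /(congr1 (fun f => fps_coef f 0%N)) /= /eqP.
by rewrite coef1 oner_eq0.
Qed.

HB.instance Definition _ := GRing.Zmodule_isComNzRing.Build (fps R)
  fps_mulA fps_mulC fps_mul1 fps_mulDl fps_one_neq0.

(* [fps_inv_seq f n] lists the coefficients of degree [0], ..., [n] of the
   inverse of [f], each one being computed from the previous ones. *)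
Fixpoint fps_inv_seq f n : seq R :=
  if n is m.+1 then
    let s := fps_inv_seq f m in
    rcons s (- (fps_coef f 0%N)^-1 *
                \sum_(i < m.+1) s`_i * fps_coef f (m.+1 - i))
  else [:: (fps_coef f 0%N)^-1].

Definition fps_unit : pred (fps R) :=
  [pred f | fps_coef f 0%N \is a GRing.unit].

Definition fps_inv f : fps R :=
  if fps_unit f then Fps (fun n => (fps_inv_seq f n)`_n) else f.

Lemma size_fps_inv_seq f n : size (fps_inv_seq f n) = n.+1.
Proof. by elim: n => //= n IH; rewrite size_rcons IH. Qed.

Lemma nth_fps_inv_seq f n i : (i <= n)%N ->
  (fps_inv_seq f n)`_i = (fps_inv_seq f i)`_i.
Proof.
elim: n => [|n IH]; first by rewrite leqn0 => /eqP ->.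
rewrite leq_eqVlt => /orP[/eqP-> //|]; rewrite ltnS => le_in /=.
by rewrite nth_rcons size_fps_inv_seq ltnS le_in IH.
Qed.

Fact fps_mulVr : {in fps_unit, left_inverse 1 fps_inv *%R}.
Proof.
move=> f uf; apply/fpsP => n; rewrite /fps_inv ifT //.
have uf0 : fps_coef f 0%N \is a GRing.unit by [].
case: n => [|n] /=; first by rewrite big_ord1 /= subnn coef1 mulVr.
rewrite big_ord_recr /= subnn coef1 /= nth_rcons size_fps_inv_seq ltnn eqxx.
rewrite mulrAC mulNr mulVr // mulN1r.
apply/eqP; rewrite subr_eq0; apply/eqP/eq_bigr => i _.
by rewrite (@nth_fps_inv_seq _ n) // -ltnS.
Qed.

Fact fps_unitPl f g : g * f = 1 -> fps_unit f.
Proof.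
move=> /(congr1 (fun h => fps_coef h 0%N)) /=.
rewrite big_ord1 /= coef1 /= subnn => gf.
by apply/unitrPr; exists (fps_coef g 0%N); rewrite mulrC.
Qed.

Fact fps_inv_out : {in [predC fps_unit], fps_inv =1 id}.
Proof. by move=> f; rewrite inE => /negbTE nuf; rewrite /fps_inv ifF. Qed.

HB.instance Definition _ := GRing.ComNzRing_hasMulInverse.Build (fps R)
  fps_mulVr fps_unitPl fps_inv_out.

(* The exponential [\sum_k f ^+ k / k!] of a series with zero constant term:
   the terms with [k > n] do not contribute to the coefficient of degree [n]. *)
Definition fps_exp f : fps R :=
  Fps (fun n => \sum_(k < n.+1) fps_coef (f ^+ k) n / k`!%:R).

End FpsRing.

Section QuotientSpace.
Variables (K : fieldType) (vT : vectType K) (U : {vspace vT}).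

Definition quotv := {quot (pred_of_vspace U)}.

HB.instance Definition _ := GRing.Zmodule.on quotv.
HB.instance Definition _ := EqQuotient.on quotv.

Definition to_quotv (v : vT) : quotv := \pi_quotv v.

Lemma to_quotv_eq v w : (to_quotv v == to_quotv w) = (v - w \in U).
Proof. by rewrite /to_quotv -(idealrBE (pred_of_vspace U)). Qed.

Lemma repr_quotvK (q : quotv) : to_quotv (repr q) = q.
Proof. exact: reprK. Qed.

Lemma to_quotvD v w : to_quotv (v + w) = to_quotv v + to_quotv w.
Proof. exact: (@pi_addr _ _ _ _ _ quotv). Qed.

Definition scaleqv (a : K) (q : quotv) : quotv := to_quotv (a *: repr q).

Lemma to_quotvZ a v : to_quotv (a *: v) = scaleqv a (to_quotv v).
Proof.
apply/eqP; rewrite to_quotv_eq -scalerBr memvZ // -to_quotv_eq.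
by rewrite repr_quotvK.
Qed.

Fact scaleqvA a b q : scaleqv a (scaleqv b q) = scaleqv (a * b) q.
Proof. by rewrite -[q]repr_quotvK -!to_quotvZ scalerA. Qed.
Fact scaleqv1 : left_id 1 scaleqv.
Proof. by move=> q; rewrite -[q]repr_quotvK -!to_quotvZ scale1r. Qed.
Fact scaleqvDr : right_distributive scaleqv +%R.
Proof.
move=> a p q; rewrite -[p]repr_quotvK -[q]repr_quotvK -to_quotvD -!to_quotvZ.
by rewrite scalerDr to_quotvD.
Qed.
Fact scaleqvDl q : {morph scaleqv^~ q : a b / a + b}.
Proof.
by move=> a b; rewrite -[q]repr_quotvK -!to_quotvZ scalerDl to_quotvD.
Qed.

HB.instance Definition _ := GRing.Zmodule_isLmodule.Build K quotv
  scaleqvA scaleqv1 scaleqvDr scaleqvDl.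

Fact to_quotv_is_linear : linear to_quotv.
Proof. by move=> a v w; rewrite to_quotvD to_quotvZ. Qed.
HB.instance Definition _ := GRing.isLinear.Build K vT quotv _ to_quotv
  to_quotv_is_linear.

Import VectorInternalTheory.
Let W := (U^C)%VS.
Let quotv_coord (q : quotv) := v2r (vsproj W (daddv_pi W U (repr q))).

Let capWU : (W :&: U = 0)%VS. Proof. by rewrite capvC capv_compl. Qed.

Let quotv_coordE v : quotv_coord (to_quotv v) = v2r (vsproj W (daddv_pi W U v)).
Proof.
congr (v2r (vsproj W _)); apply/eqP; rewrite -subr_eq0 -linearB /=.
have : repr (to_quotv v) - v \in U by rewrite -to_quotv_eq repr_quotvK.
set u := _ - v => uU; have := daddv_pi_id (etrans (capvC U W) capWU) uU.
have := daddv_pi_add capWU (subvP (addvSr W U) _ uU).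
by move=> + eu; rewrite eu => /eqP; rewrite -subr_eq0 addrK.
Qed.

Fact quotv_vect_iso : Vector.axiom (dim (subvs_of W)) quotv.
Proof.
exists quotv_coord.
  move=> a p q; rewrite -[p]repr_quotvK -[q]repr_quotvK -linearP !quotv_coordE.
  by rewrite !linearP.
exists (fun r => to_quotv (vsval (r2v r : subvs_of W))) => [q|r].
  rewrite -{2}[q]repr_quotvK -[q in quotv_coord q]repr_quotvK quotv_coordE v2rK.
  apply/eqP; rewrite vsprojK ?memv_pi // to_quotv_eq.
  have /(daddv_pi_add capWU) eqv : repr q \in (W + U)%VS.
    by rewrite addvC addv_complf memvf.
  by rewrite -{2}eqv opprD addNKr memvN memv_pi.
by rewrite quotv_coordE daddv_pi_id ?subvsP // vsvalK r2vK.
Qed.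

HB.instance Definition _ := Lmodule_hasFinDim.Build K quotv quotv_vect_iso.

End QuotientSpace.

Definition lfun_trace (K : fieldType) (vT : vectType K) (f : 'End(vT)) : K :=
  \tr (passmx.mxof (vbasis {:vT}) (vbasis {:vT}) f).

Record sgraph := SGraph {
  vertex :> finType;
  adj : rel vertex;
  adj_sym : symmetric adj;
  adj_irrefl : irreflexive adj }.

Definition graph_aut (G : sgraph) : {set {perm G}} :=
  [set T : {perm G} | [forall x, forall y, adj (T x) (T y) == adj x y]].

Lemma graph_autP (G : sgraph) (T : {perm G}) :
  reflect (forall x y, adj (T x) (T y) = adj x y) (T \in graph_aut G).
Proof.
rewrite inE; apply: (iffP forallP) => [aT x y | aT x]; last first.
  by apply/forallP => y; rewrite aT.
by apply/eqP; move: y; apply/forallP.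
Qed.

Fact graph_aut_group_set (G : sgraph) : group_set (graph_aut G).
Proof.
apply/group_setP; split=> [|S T /graph_autP aS /graph_autP aT].
  by apply/graph_autP => x y; rewrite !perm1.
by apply/graph_autP => x y; rewrite !permM aT aS.
Qed.

Canonical graph_aut_group (G : sgraph) := Group (graph_aut_group_set G).

Definition is_simplex (G : sgraph) (x : {set G}) : bool :=
  (x != set0) && [forall u in x, forall v in x, (u != v) ==> adj u v].

Definition is_ordered_simplex (G : sgraph) k (x : {ffun 'I_k.+1 -> G}) : bool :=
  [forall i, forall j, (i != j) ==> adj (x i) (x j)].

Definition osimplex (G : sgraph) k :=
  {x : {ffun 'I_k.+1 -> G} | is_ordered_simplex x}.

Lemma is_ordered_simplexP (G : sgraph) k (x : {ffun 'I_k.+1 -> G}) :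
  reflect (forall i j, i != j -> adj (x i) (x j)) (is_ordered_simplex x).
Proof.
apply: (iffP forallP) => [xP i j ne_ij | xP i].
  by have /forallP/(_ j)/implyP := xP i; apply.
by apply/forallP => j; apply/implyP; apply: xP.
Qed.

Section OrderedSimplices.
Variables (G : sgraph) (k : nat).

Fact oface_subproof (i : 'I_k.+2) (x : osimplex G k.+1) :
  is_ordered_simplex [ffun j => val x (lift i j)].
Proof.
apply/is_ordered_simplexP => j l ne_jl; rewrite !ffunE.
by apply: (elimT (is_ordered_simplexP _) (valP x)); rewrite (inj_eq lift_inj).
Qed.
Definition oface i x : osimplex G k := Sub _ (oface_subproof i x).

Fact operm_subproof (s : 'S_k.+1) (x : osimplex G k) :
  is_ordered_simplex [ffun i => val x (s i)].
Proof.
apply/is_ordered_simplexP => i j ne_ij; rewrite !ffunE.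
by apply: (elimT (is_ordered_simplexP _) (valP x)); rewrite (inj_eq perm_inj).
Qed.
Definition operm s x : osimplex G k := Sub _ (operm_subproof s x).

Fact oaut_subproof (T : [subg graph_aut G]) (x : osimplex G k) :
  is_ordered_simplex [ffun i => sgval T (val x i)].
Proof.
apply/is_ordered_simplexP => i j ne_ij; rewrite !ffunE.
have /graph_autP -> := subgP T.
exact: (elimT (is_ordered_simplexP _) (valP x)).
Qed.
Definition oaut T x : osimplex G k := Sub _ (oaut_subproof T x).

End OrderedSimplices.

Section Cohomology.
Variables (R : realType) (G : sgraph).

(* All real functions on the ordered [k]-simplices, antisymmetric or not. *)
Definition cochain k := {ffun osimplex G k -> R^o}.

Definition antisym_fun k (s : 'S_k.+1) (f : cochain k) : cochain k :=
  [ffun x => f (operm s x) - (-1) ^+ s * f x].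
Fact antisym_fun_is_linear k s : linear (@antisym_fun k s).
Proof.
move=> a f g; apply/ffunP => x; rewrite !ffunE mulrDr -scalerAr.
by rewrite scalerBr opprD addrACA.
Qed.
HB.instance Definition _ k s := GRing.isLinear.Build R (cochain k) (cochain k) _
  (@antisym_fun k s) (@antisym_fun_is_linear k s).

Definition forms k : {vspace cochain k} :=
  (\bigcap_(s : 'S_k.+1) lker (linfun (antisym_fun s)))%VS.

Lemma formsP k (f : cochain k) :
  reflect (forall (s : 'S_k.+1) x, f (operm s x) = (-1) ^+ s * f x)
          (f \in forms k).
Proof.
apply: (iffP idP) => [+ s x | fP].
  rewrite memvE => /subv_bigcapP/(_ s isT).
  rewrite -memvE memv_ker lfunE /= => /eqP/ffunP/(_ x).
  by rewrite !ffunE => /eqP; rewrite subr_eq0 => /eqP.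
rewrite memvE; apply/subv_bigcapP => s _; rewrite -memvE memv_ker lfunE /=.
by apply/eqP/ffunP => x; rewrite !ffunE fP subrr.
Qed.

Definition ext_deriv_fun k (f : cochain k) : cochain k.+1 :=
  [ffun x => \sum_(i < k.+2) (-1) ^+ i * f (oface i x)].
Fact ext_deriv_fun_is_linear k : linear (@ext_deriv_fun k).
Proof.
move=> a f g; apply/ffunP => x; rewrite !ffunE scaler_sumr -big_split /=.
by apply: eq_bigr => i _; rewrite !ffunE mulrDr scalerAr.
Qed.
HB.instance Definition _ k := GRing.isLinear.Build R (cochain k) (cochain k.+1) _
  (@ext_deriv_fun k) (@ext_deriv_fun_is_linear k).
Definition ext_deriv k : 'Hom(cochain k, cochain k.+1) :=
  linfun (@ext_deriv_fun k).

Lemma ext_derivE k (f : cochain k) x :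
  ext_deriv k f x = \sum_(i < k.+2) (-1) ^+ i * f (oface i x).
Proof. by rewrite lfunE /= ffunE. Qed.

Definition closed_forms k : {vspace cochain k} :=
  (forms k :&: lker (ext_deriv k))%VS.

Definition exact_forms k : {vspace cochain k} :=
  match k with
  | 0 => 0%VS
  | k'.+1 => (ext_deriv k' @: forms k')%VS
  end.

(* The exact [k]-forms, as a subspace of the space of closed [k]-forms. *)
Definition exact_in_closed k : {vspace subvs_of (closed_forms k)} :=
  (linfun (@vsval R (cochain k) (closed_forms k)) @^-1: exact_forms k)%VS.

Definition cohomology k := quotv (exact_in_closed k).
HB.instance Definition _ k := Vector.on (cohomology k).

Definition to_coh k (f : subvs_of (closed_forms k)) : cohomology k :=
  to_quotv (exact_in_closed k) f.

Definition pullback_fun k (T : [subg graph_aut G]) (f : cochain k) : cochain k :=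
  [ffun x => f (oaut T x)].
Fact pullback_fun_is_linear k T : linear (@pullback_fun k T).
Proof. by move=> a f g; apply/ffunP => x; rewrite !ffunE. Qed.
HB.instance Definition _ k T := GRing.isLinear.Build R (cochain k) (cochain k) _
  (@pullback_fun k T) (@pullback_fun_is_linear k T).
Definition pullback k T : 'End(cochain k) := linfun (@pullback_fun k T).

Lemma pullbackE k T (f : cochain k) x : pullback k T f x = f (oaut T x).
Proof. by rewrite lfunE /= ffunE. Qed.

Lemma ext_deriv_pullback k T (f : cochain k) :
  ext_deriv k (pullback k T f) = pullback k.+1 T (ext_deriv k f).
Proof.
apply/ffunP => x; rewrite pullbackE !ext_derivE; apply: eq_bigr => i _.
rewrite pullbackE; congr (_ * f _); apply/val_inj/ffunP => j /=.
by rewrite !ffunE.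
Qed.

Lemma pullback_forms k T (f : cochain k) :
  f \in forms k -> pullback k T f \in forms k.
Proof.
move=> /formsP fP; apply/formsP => s x; rewrite !pullbackE -fP.
by congr (f _); apply/val_inj/ffunP => j /=; rewrite !ffunE.
Qed.

Lemma pullback_closed k T (f : cochain k) :
  f \in closed_forms k -> pullback k T f \in closed_forms k.
Proof.
rewrite !memv_cap => /andP[/(pullback_forms T) -> /=].
by rewrite !memv_ker ext_deriv_pullback => /eqP ->; rewrite linear0.
Qed.

Lemma pullback_exact k T (f : cochain k) :
  f \in exact_forms k -> pullback k T f \in exact_forms k.
Proof.
case: k f => [|k] f /=; first by rewrite !memv0 => /eqP ->; rewrite linear0.
case/memv_imgP => g gP ->; rewrite -ext_deriv_pullback.
by rewrite memv_img // pullback_forms.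
Qed.

Definition pullback_closed_forms k T (f : subvs_of (closed_forms k)) :
    subvs_of (closed_forms k) :=
  Subvs (pullback_closed T (subvsP f)).

Definition coh_map_fun k T (c : cohomology k) : cohomology k :=
  to_coh (pullback_closed_forms T (repr c)).

Lemma coh_map_funE k T (f : subvs_of (closed_forms k)) :
  coh_map_fun T (to_coh f) = to_coh (pullback_closed_forms T f).
Proof.
apply/eqP; rewrite /coh_map_fun /to_coh to_quotv_eq -memv_preim lfunE /=.
rewrite -linearB pullback_exact //.
have := repr_quotvK (to_quotv (exact_in_closed k) f).
by move/eqP; rewrite to_quotv_eq -memv_preim lfunE.
Qed.

Fact coh_map_fun_is_linear k T : linear (@coh_map_fun k T).
Proof.
move=> a c c'; rewrite -[c]repr_quotvK -[c']repr_quotvK -linearP.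
rewrite -!/(to_coh _) !coh_map_funE -linearP; congr to_coh.
by apply/val_inj; rewrite /= !linearP.
Qed.
HB.instance Definition _ k T :=
  GRing.isLinear.Build R (cohomology k) (cohomology k) _
    (@coh_map_fun k T) (@coh_map_fun_is_linear k T).
Definition coh_map k T : 'End(cohomology k) := linfun (@coh_map_fun k T).

(* There are no [k]-simplices, hence no cohomology, for [k >= #|G|]. *)
Definition lefschetz (T : [subg graph_aut G]) : R :=
  \sum_(k < #|G|) (-1) ^+ k * lfun_trace (coh_map k T).

Definition zeta (T : [subg graph_aut G]) : fps R :=
  fps_exp (Fps (fun n =>
    if n is 0 then 0 else lefschetz (T ^+ n)%g / n%:R)).

End Cohomology.

Section Orbits.
Variables (G : sgraph) (T : [subg graph_aut G]).

Definition simplex_iter n (x : {set G}) : {set G} := (sgval T ^+ n)%g @: x.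

Definition simplex_orbit p (x : {set G}) : {set {set G}} :=
  [set simplex_iter i x | i : 'I_p].

Definition has_prime_period p (x : {set G}) : bool :=
  [&& is_simplex x, #|simplex_orbit p x| == p & simplex_iter p x == x].

Definition odd_dim (x : {set G}) : bool := odd #|x|.-1.

(* When [sgval T ^+ p] maps [x] to itself, [restr_perm x] keeps its action on [x]
   and makes it the identity outside [x], which does not change the signature. *)
Definition negative_sign p (x : {set G}) : bool :=
  odd_perm (restr_perm x (sgval T ^+ p)%g).

(* The dimension and the sign do not depend on the representative [x] of the
   orbit. *)
Definition num_orbits p (P : pred {set G}) : nat :=
  #|[set simplex_orbit p x | x in {set G} & has_prime_period p x && P x]|.

Definition orbits_a p := num_orbits p [pred x | odd_dim x && ~~ negative_sign p x].
Definition orbits_b p :=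
  num_orbits p [pred x | ~~ odd_dim x && ~~ negative_sign p x].
Definition orbits_c p := num_orbits p [pred x | odd_dim x && negative_sign p x].
Definition orbits_d p :=
  num_orbits p [pred x | ~~ odd_dim x && negative_sign p x].

End Orbits.

(* Main.v *)
Require Import Defs.
From HB Require Import structures.
From mathcomp Require Import all_boot all_order all_algebra all_fingroup.
From mathcomp Require generic_quotient.
From mathcomp Require Import reals zify ring.

(** Both sides have constant term 1, so it suffices to compare their
    logarithmic derivatives ([log_deriv_inj]). On the left the coefficient
    of degree [n] of the logarithmic derivative is [L(T ^ n.+1)]
    ([has_log_deriv_exp]); on the right, a factor [1 - c * z ^ p]
    contributes [- p * c ^ m] in degree [p * m - 1], for all [m > 0], and
    nothing in the other degrees ([has_log_deriv_binomial]).

    The numbers [L(T ^ n)] are computed by a fixed point formula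
    ([lefschetz_fixed_simplices]): [L(T)] is the sum, over the simplices
    [x] that [T] maps to themselves, of [(-1) ^ dim x] times the signature
    of [T] on [x]. It has two ingredients. By additivity of the trace in
    short exact sequences, the alternating sum of the traces on cohomology
    is equal to the one on forms ([hopf_trace_formula]). The trace on
    [k]-forms is the trace, on all functions of ordered simplices, of the
    pull-back composed with antisymmetrization; in the basis of delta
    functions, an ordered simplex contributes the signature of [T] over [(k
    + 1)!] if [T] permutes its vertices, and 0 otherwise, and each simplex
    has [(k + 1)!] orderings ([trace_on_forms_fixed_simplices]).

    Finally [T ^ n] fixes a simplex [x] of minimal period [p] exactly when
    [p] divides [n], in which case its signature on [x] is the power of
    exponent [n / p] of that of [T ^ p]. As an orbit of period [p] contains
    [p] simplices, summing over the orbits gives the coefficients found for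
    the right-hand side ([lefschetz_iterate]). *)

Set Implicit Arguments.
Unset Strict Implicit.
Unset Printing Implicit Defensive.

Import Order.TTheory GRing.Theory Num.Theory.

Local Open Scope ring_scope.

(** * Traces of endomorphisms and of their restrictions *)

Section Trace.
Variable K : fieldType.
Implicit Types U V W : vectType K.

Lemma lfun_traceC U V (f : 'Hom(U, V)) (g : 'Hom(V, U)) :
  lfun_trace (f \o g)%VF = lfun_trace (g \o f)%VF.
Proof.
rewrite /lfun_trace (passmx.mxof_comp _ _ (vbasisP {:U})).
by rewrite (passmx.mxof_comp _ _ (vbasisP {:V})) mxtrace_mulC.
Qed.

Fact lfun_trace_is_linear V : linear (@lfun_trace K V : _ -> K^o).
Proof. by move=> a f g; rewrite /lfun_trace passmx.mxof_linear linearP. Qed.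
HB.instance Definition _ V := GRing.isLinear.Build K 'End(V) K^o _
  (@lfun_trace K V) (@lfun_trace_is_linear V).

Lemma lfun_trace1 V : lfun_trace (\1%VF : 'End(V)) = (\dim {:V})%:R.
Proof.
by rewrite /lfun_trace passmx.mxof1 ?mxtrace1 ?(basis_free (vbasisP _)).
Qed.

Lemma lfun_trace_regular (f : 'End(K^o)) : lfun_trace f = f 1.
Proof.
have ef : f = f 1 *: \1%VF.
  apply/lfunP => x; rewrite scale_lfunE id_lfunE.
  rewrite -[x in LHS](mulr1 (x : K)) [x * 1 : K](_ : _ = x *: (1 : K^o)) //.
  by rewrite linearZ /= [RHS]mulrC.
rewrite {1}ef linearZ /= lfun_trace1 dimvf /= /dim /=.
by rewrite [LHS]mulr1.
Qed.

(** The trace of the compression of [f] to the subspace [U]; when [f]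
    stabilises [U], the trace of the restriction of [f] to [U]. *)
Definition trace_on V (f : 'End(V)) (U : {vspace V}) : K :=
  lfun_trace (f \o projv U)%VF.

(** [f] maps [U] to itself. *)
Definition stable V (f : 'End(V)) (U : {vspace V}) :=
  forall v, v \in U -> f v \in U.

(** Any projection onto a stable subspace computes the trace on it. *)
Lemma trace_on_projection V (f P : 'End(V)) (U : {vspace V}) :
    stable f U -> (forall v, P v \in U) -> (forall v, v \in U -> P v = v) ->
  trace_on f U = lfun_trace (f \o P)%VF.
Proof.
move=> fU PU Pid; rewrite /trace_on.
have -> : projv U = (P \o projv U)%VF.
  by apply/lfunP => v; rewrite comp_lfunE Pid ?memv_proj.
rewrite comp_lfunA lfun_traceC; congr lfun_trace; apply/lfunP => v.
by rewrite !comp_lfunE projv_id // fU.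
Qed.

Lemma trace_on_fullv V (f : 'End(V)) : trace_on f {:V} = lfun_trace f.
Proof.
rewrite (@trace_on_projection _ _ \1%VF) ?comp_lfun1r // => v *;
  by rewrite ?memvf // lfunE.
Qed.

Lemma trace_on0 V (f : 'End(V)) : trace_on f 0%VS = 0.
Proof.
rewrite /trace_on (_ : (_ \o _)%VF = 0) ?linear0 //.
apply/lfunP => v; rewrite comp_lfunE lfunE /=.
have /eqP -> : projv 0 v == 0 by rewrite -memv0 memv_proj.
by rewrite linear0.
Qed.

(** Additivity of the trace along [0 -> U :&: lker D -> U -> D @: U -> 0]. *)
Lemma trace_on_exact V W (D : 'Hom(V, W)) (f : 'End(V)) (g : 'End(W))
    (U : {vspace V}) :
    stable f U -> (forall v, v \in U -> D (f v) = g (D v)) ->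
  trace_on f U = trace_on f (U :&: lker D)%VS + trace_on g (D @: U)%VS.
Proof.
move=> fU Df; pose Q := projv U.
(* a section of [D] over [D @: U] with values in [U] *)
have [s sU Ds] : exists2 s : 'Hom(W, V), forall w, s w \in U &
    forall w, w \in (D @: U)%VS -> D (s w) = w.
  exists (Q \o (D \o Q)^-1)%VF => w; first by rewrite comp_lfunE memv_proj.
  move=> wI; rewrite comp_lfunE -[D (Q _)]comp_lfunE limg_lfunVK //.
  by rewrite limg_comp limg_proj.
(* subtracting from a vector of [U] the lift of its image by [D] projects [U]
   onto the kernel of [D] in [U] *)
rewrite (@trace_on_projection _ _ (Q - (s \o D \o Q))%VF (U :&: lker D)%VS).
- rewrite comp_lfunDr linearD /= -addrA -[LHS]addr0; congr (_ + _).
  rewrite comp_lfunNr linearN /=; apply/esym/eqP; rewrite addrC subr_eq0.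
  have -> : (s \o D \o Q)%VF = ((s \o projv (D @: U)%VS) \o (D \o Q))%VF.
    apply/lfunP => v; rewrite !comp_lfunE [projv (D @: U)%VS _]projv_id //.
    by rewrite memv_img ?memv_proj.
  rewrite comp_lfunA lfun_traceC; apply/eqP; congr lfun_trace.
  apply/lfunP => w; rewrite !comp_lfunE.
  by rewrite [Q _]projv_id ?fU // Df // Ds // memv_proj.
- move=> v; rewrite memv_cap memv_ker => /andP[vU /eqP Dv].
  by rewrite memv_cap fU // memv_ker Df // Dv linear0 eqxx.
- move=> v; rewrite !lfunE /= opp_lfunE !comp_lfunE memv_cap.
  rewrite memvB ?memv_proj ?sU // memv_ker linearB /= Ds ?subrr ?eqxx //.
  by rewrite memv_img ?memv_proj.
move=> v; rewrite memv_cap memv_ker => /andP[vU /eqP Dv].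
by rewrite !lfunE /= opp_lfunE !comp_lfunE projv_id // Dv linear0 subr0.
Qed.

(** For a subspace [E] of [C], the trace on [E] can be computed in the vector
    space underlying [C], where [f'] is the restriction of [f]. *)
Lemma trace_on_subvs V (C E : {vspace V}) (f : 'End(V))
    (f' : 'End(subvs_of C)) :
    stable f E -> (E <= C)%VS -> (forall u, vsval (f' u) = f (vsval u)) ->
  trace_on f' (linfun (@vsval K V C) @^-1: E)%VS = trace_on f E.
Proof.
move=> fE sEC f'E; pose v := linfun (@vsval K V C).
pose p := linfun (@vsproj K V C).
rewrite (@trace_on_projection _ _ (p \o projv E \o v)%VF).
- rewrite comp_lfunA lfun_traceC; congr lfun_trace.
  apply/lfunP => x; rewrite !comp_lfunE !lfunE /= f'E.
  by rewrite vsprojK // (subvP sEC) // memv_proj.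
- by move=> u; rewrite -!memv_preim !lfunE /= f'E; apply: fE.
- move=> u; rewrite -memv_preim !comp_lfunE !lfunE /= vsprojK ?memv_proj //.
  by rewrite (subvP sEC) // memv_proj.
move=> u; rewrite -memv_preim !comp_lfunE !lfunE /= => uE.
by rewrite projv_id // vsvalK.
Qed.

Section FiniteFunctions.
Variable I : finType.
Local Notation V := {ffun I -> K^o}.

(** Evaluation at [i], and its section: the function with value [a] at [i] and
    0 elsewhere. *)
Definition ffun_eval (i : I) (f : V) : K^o := f i.
Fact ffun_eval_is_linear i : linear (ffun_eval i).
Proof. by move=> a f g; rewrite /ffun_eval !ffunE. Qed.
HB.instance Definition _ i := GRing.isLinear.Build K V K^o _
  (ffun_eval i) (ffun_eval_is_linear i).

Definition ffun_delta (i : I) (a : K^o) : V :=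
  [ffun j => if j == i then a else 0].
Fact ffun_delta_is_linear i : linear (ffun_delta i).
Proof.
move=> a b c; apply/ffunP => j; rewrite !ffunE.
by case: eqP; rewrite ?scaler0 ?addr0.
Qed.
HB.instance Definition _ i := GRing.isLinear.Build K K^o V _
  (ffun_delta i) (ffun_delta_is_linear i).

(** The trace of an endomorphism of the functions on a finite set, read off the
    basis of delta functions. *)
Lemma lfun_trace_ffun (f : 'End(V)) :
  lfun_trace f = \sum_i f (ffun_delta i 1) i.
Proof.
have ef : f = \sum_i ((f \o linfun (ffun_delta i)) \o linfun (ffun_eval i))%VF.
  (* [u] is the sum of its values times the delta functions *)
  apply/lfunP => u; rewrite sum_lfunE.
  rewrite -[in LHS](_ : \sum_i ffun_delta i (u i) = u).
    by rewrite linear_sum; apply: eq_bigr => i _; rewrite !comp_lfunE !lfunE.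
  apply/ffunP => j; rewrite sum_ffunE (bigD1 j) //= ffunE eqxx big1 ?addr0 //.
  by move=> i ne_ij; rewrite ffunE eq_sym (negbTE ne_ij).
rewrite {1}ef linear_sum; apply: eq_bigr => i _ /=.
by rewrite lfun_traceC lfun_trace_regular !comp_lfunE !lfunE.
Qed.
End FiniteFunctions.
End Trace.

(** * The Hopf trace formula *)

(** Removing the vertex [i] after permuting by [s] amounts to removing [s i]
    and then permuting the remaining vertices. *)
Lemma oface_operm (G : sgraph) k (i : 'I_k.+2) (s : 'S_k.+2)
    (x : osimplex G k.+1) :
  exists2 s' : 'S_k.+1, odd_perm s' = odd i (+) odd (s i) (+) odd_perm s &
    oface i (operm s x) = operm s' (oface (s i) x).
Proof.
have inj_s' : injective (fun j => odflt j (unlift (s i) (s (lift i j)))).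
  move=> j l /=; case: unliftP => [j'|/perm_inj/eqP]; last first.
    by rewrite eq_sym (negbTE (neq_lift _ _)).
  move=> sj; case: unliftP => [l'|/perm_inj/eqP]; last first.
    by rewrite eq_sym (negbTE (neq_lift _ _)).
  by move=> sl /= jl; apply/(@lift_inj _ i)/(@perm_inj _ s); rewrite sj sl jl.
pose s' := perm inj_s'.
have s'E j : lift (s i) (s' j) = s (lift i j).
  rewrite permE /=; case: unliftP => [j' -> //|/perm_inj/eqP].
  by rewrite eq_sym (negbTE (neq_lift _ _)).
exists s'.
  have -> : s = lift_perm i (s i) s'.
    apply/permP => j; case: (unliftP i j) => [j'|] ->.
      by rewrite lift_perm_lift s'E.
    by rewrite lift_perm_id.
  by rewrite lift_perm_id odd_lift_perm addbA addbb.
by apply/val_inj/ffunP => j /=; rewrite !ffunE /= s'E.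
Qed.

Section Hopf.
Variables (R : realType) (G : sgraph) (T : [subg graph_aut G]).

Lemma ext_deriv_forms k (f : cochain R G k) :
  f \in forms R G k -> ext_deriv R G k f \in forms R G k.+1.
Proof.
move=> /formsP fP; apply/formsP => s x; rewrite !ext_derivE big_distrr /=.
rewrite [RHS](reindex_inj (@perm_inj _ s)) /=; apply: eq_bigr => i _.
have [s' odd_s' ->] := oface_operm i s x.
rewrite fP odd_s' !mulrA; congr (_ * _).
rewrite -signr_odd -[in RHS](signr_odd _ (s i)) -!signr_addb.
by congr (_ ^+ _); case: (odd i); case: (odd (s i)); case: (odd_perm s).
Qed.

Lemma ext_deriv_ext_deriv k (f : cochain R G k) :
  ext_deriv R G k.+1 (ext_deriv R G k f) = 0.
Proof.
apply/ffunP => x; rewrite ext_derivE [RHS]ffunE.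
under eq_bigr => i _ do rewrite ext_derivE big_distrr /=.
rewrite pair_big /=; set S := (X in X = _).
(* a face missing two vertices occurs twice, with opposite signs: [h] exchanges
   the order in which these vertices are removed *)
have [h h1E h2E] : exists2 h : 'I_k.+3 * 'I_k.+2 -> 'I_k.+3 * 'I_k.+2,
    forall p, (h p).1 = (if p.2 < p.1 then p.2 : nat else p.2.+1)%N :> nat &
    forall p, (h p).2 = (if p.2 < p.1 then p.1.-1 else p.1)%N :> nat.
  exists (fun p => (lift p.1 p.2,
      inord (if (p.2 < p.1)%N then p.1.-1 else p.1))) => -[i j] /=.
    by rewrite /bump; case: ltnP; lia.
  rewrite inordK //.
  by move: (ltn_ord i) (ltn_ord j); case: (ltnP j i); lia.
have hK : involutive h.
  move=> p; rewrite [RHS]surjective_pairing [LHS]surjective_pairing.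
  congr (_, _); apply/val_inj; move: (h1E p) (h2E p) (h1E (h p)) (h2E (h p));
    move: (h (h p)) (h p) => q r -> -> /= e1 e2; rewrite ?(e1, e2);
    by case: (ltnP p.2 p.1) => lt_p; case: ltnP; lia.
suff /eqP : S = - S by rewrite eq_sym eqNr => /eqP.
rewrite {1}/S (reindex_inj (inv_inj hK)) /= /S -sumrN.
apply: eq_bigr => p _.
have -> : oface (h p).2 (oface (h p).1 x) = oface p.2 (oface p.1 x).
  apply/val_inj/ffunP => l; rewrite !ffunE; congr (val x _); apply/val_inj.
  have:= h1E p; have := h2E p; rewrite /= /bump => -> ->; case: ltnP; lia.
rewrite !mulrA -mulNr; congr (_ * _).
rewrite -!exprD -[RHS]mulN1r -exprS -signr_odd -[RHS]signr_odd h1E h2E.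
by congr (_ ^+ nat_of_bool _); case: ltnP; lia.
Qed.

Lemma sub_exact_closed k : (exact_forms R G k <= closed_forms R G k)%VS.
Proof.
case: k => [|k]; first by rewrite /= sub0v.
apply/subvP => _ /memv_imgP[g gP ->]; rewrite memv_cap ext_deriv_forms //.
by rewrite memv_ker ext_deriv_ext_deriv eqxx.
Qed.

(** The exterior derivative maps the [k]-forms onto the exact [k.+1]-forms, with
    kernel the closed [k]-forms. *)
Lemma trace_on_forms k :
  trace_on (pullback R k T) (forms R G k) =
    trace_on (pullback R k T) (closed_forms R G k) +
    trace_on (pullback R k.+1 T) (exact_forms R G k.+1).
Proof.
apply: trace_on_exact => f; first exact: pullback_forms.
by rewrite ext_deriv_pullback.
Qed.

(** The cohomology is the quotient of the closed forms by the exact ones. *)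
Lemma trace_coh_map k :
  lfun_trace (coh_map R k T) =
    trace_on (pullback R k T) (closed_forms R G k) -
    trace_on (pullback R k T) (exact_forms R G k).
Proof.
set C := closed_forms R G k; set E := exact_forms R G k.
have [f' f'E] : exists f' : 'End(subvs_of C),
    forall u, vsval (f' u) = pullback R k T (vsval u).
  exists (linfun (@vsproj _ _ C) \o pullback R k T \o
          linfun (@vsval _ _ C))%VF => u.
  rewrite !comp_lfunE [linfun (@vsval _ _ _) _]lfunE.
  rewrite [linfun (@vsproj _ _ _) _]lfunE /= vsprojK //.
  by rewrite pullback_closed // subvsP.
(* [D] is the projection of the closed forms onto the cohomology: it is
   surjective, with kernel the exact forms *)
pose D : 'Hom(subvs_of C, cohomology R G k) :=
  linfun (to_quotv (exact_in_closed R G k)).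
have := @trace_on_exact _ _ _ D f' (coh_map R k T) {:subvs_of C}%VS.
have -> : (D @: fullv)%VS = {:cohomology R G k}%VS.
  apply/vspaceP => q; rewrite memvf; apply/memv_imgP.
  by exists (generic_quotient.repr q); rewrite ?memvf // lfunE /= repr_quotvK.
have -> : (fullv :&: lker D)%VS = (linfun (@vsval _ _ C) @^-1: E)%VS.
  apply/vspaceP => u; rewrite memv_cap memvf memv_ker lfunE /=.
  by rewrite -(linear0 (to_quotv (exact_in_closed R G k))) to_quotv_eq subr0.
rewrite !trace_on_fullv => tr; apply/esym/eqP; rewrite subr_eq addrC; apply/eqP.
rewrite -(trace_on_subvs (E := E) _ (sub_exact_closed k) f'E); last first.
  by move=> f; apply: pullback_exact.
rewrite -tr.
- rewrite -trace_on_fullv -(trace_on_subvs (E := C) _ (subvv _) f'E).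
    congr trace_on; apply/vspaceP => u.
    by rewrite memvf -memv_preim lfunE /= subvsP.
  by move=> f; apply: pullback_closed.
- by move=> u _; rewrite memvf.
have DE u : D u = to_coh u by rewrite lfunE.
move=> u _; rewrite !DE /coh_map lfunE /= coh_map_funE; congr to_coh.
by apply/val_inj; rewrite /= f'E.
Qed.

(** The vertices of an ordered [k]-simplex are [k.+1] distinct vertices. *)
Lemma osimplex_inj k (x : osimplex G k) : injective (val x).
Proof.
move=> i j xij; apply/eqP/negPn/negP => ne_ij.
have := elimT (is_ordered_simplexP _) (valP x) i j ne_ij.
by rewrite xij adj_irrefl.
Qed.

Lemma cochain_card0 (f : cochain R G #|G|) : f = 0.
Proof.
apply/ffunP => x; have := leq_card _ (@osimplex_inj _ x).
by rewrite card_ord ltnn.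
Qed.

(** The Lefschetz number can be computed on forms rather than on cohomology:
    the contributions of the exact forms cancel telescopically. *)
Lemma hopf_trace_formula :
  lefschetz R T =
    \sum_(k < #|G|) (-1) ^+ k * trace_on (pullback R k T) (forms R G k).
Proof.
pose e k := trace_on (pullback R k T) (exact_forms R G k).
have telescope n : \sum_(k < n) (-1) ^+ k * lfun_trace (coh_map R k T) =
    \sum_(k < n) (-1) ^+ k * trace_on (pullback R k T) (forms R G k)
    + (-1) ^+ n * e n.
  elim: n => [|n IH]; first by rewrite !big_ord0 /e trace_on0 mulr0 addr0.
  rewrite !big_ord_recr /= {}IH trace_coh_map trace_on_forms exprS.
  rewrite -/(e n) -/(e n.+1).
  by ring.
(* every cochain of degree [#|G|] vanishes, hence so does the last term *)
rewrite /lefschetz telescope [e _](_ : _ = 0) ?mulr0 ?addr0 // /e.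
have -> : exact_forms R G #|G| = 0%VS; last exact: trace_on0.
by apply/vspaceP => f; rewrite [f]cochain_card0 !mem0v.
Qed.

End Hopf.

(** * The trace on forms *)

(** Signature is preserved when a permutation is transported along an injection
    and extended by the identity. *)
Lemma odd_perm_transport (I V : finType) (x : I -> V) (s : {perm I})
    (t : {perm V}) :
    injective x -> (forall i, t (x i) = x (s i)) ->
    (forall v, (forall i, v != x i) -> t v = v) ->
  odd_perm t = odd_perm s.
Proof.
move=> x_inj; have [ts -> _] := prod_tpermP s.
elim: ts t => [|[i j] ts IH] t /= tx tid.
  rewrite big_nil odd_perm1 -(odd_perm1 V); congr odd_perm; apply/permP => v.
  have [[l ->]|vx] : (exists l, v = x l) \/ (forall l, v != x l).
  - case: (pickP [pred l | v == x l]) => [l /eqP|vx]; first by left; exists l.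
    by right => l; apply: negbT (vx l).
  - by rewrite tx big_nil !perm1.
  - by rewrite tid ?perm1.
have xtperm l : tperm (x i) (x j) (x l) = x (tperm i j l).
  case: (tpermP i j) => [->|->|/eqP li /eqP lj]; rewrite ?tpermL ?tpermR //.
  by rewrite tpermD // (inj_eq x_inj) eq_sym.
have := IH (tperm (x i) (x j) * t)%g.
rewrite big_cons /= !odd_permM !odd_tperm (inj_eq x_inj) => <-.
- by rewrite addbA addbb.
- by move=> l; rewrite permM xtperm tx big_cons !permM tpermK.
- by move=> v vx; rewrite permM tpermD 1?eq_sym ?vx // tid.
Qed.

Section OrderedSimplex.
Variables (G : sgraph) (k : nat).
Implicit Types (x : osimplex G k) (s t : 'S_k.+1).

(** The simplex underlying an ordered simplex. *)
Definition vertices x : {set G} := [set val x i | i : 'I_k.+1].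

Lemma operm_comp s t x : operm s (operm t x) = operm (s * t)%g x.
Proof. by apply/val_inj/ffunP => i /=; rewrite !ffunE /= ?ffunE permM. Qed.

Lemma card_vertices x : #|vertices x| = k.+1.
Proof. by rewrite card_imset ?card_ord //; apply: osimplex_inj. Qed.

Lemma is_simplex_vertices x : is_simplex (vertices x).
Proof.
rewrite /is_simplex -card_gt0 card_vertices /=.
apply/forallP => u; apply/implyP => /imsetP[i _ ->].
apply/forallP => v; apply/implyP => /imsetP[j _ ->]; apply/implyP => ne_ij.
apply: (elimT (is_ordered_simplexP _) (valP x)).
by apply: contraNneq ne_ij => ->.
Qed.

(** A [k]-simplex has [k.+1]! orderings. *)
Lemma card_orderings (A : {set G}) : is_simplex A -> #|A| = k.+1 ->
  #|[set x | vertices x == A]| = k.+1`!.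
Proof.
move=> /andP[_ Aadj] cardA.
have := @card_inj_ffuns_on 'I_k.+1 G (mem A).
rewrite cardA card_ord ffactnn => <-.
rewrite -(card_imset _ val_inj); congr #|pred_of_set _|.
apply/setP => f; rewrite inE.
apply/imsetP/andP => [[x]|[/ffun_onP fA /injectiveP finj]].
  rewrite inE => /eqP <- ->; split.
    by apply/ffun_onP => i; apply: imset_f.
  by apply/injectiveP; apply: osimplex_inj.
have fP : is_ordered_simplex f.
  apply/is_ordered_simplexP => i j ne_ij.
  have /forallP/(_ (f i))/implyP/(_ (fA i))/forallP/(_ (f j)) := Aadj.
  by move=> /implyP/(_ (fA j))/implyP; apply; rewrite (inj_eq finj).
exists (Sub f fP : osimplex G k); last by [].
rewrite inE eqEcard cardA card_vertices leqnn andbT.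
by apply/subsetP => v /imsetP[i _ ->] /=; apply: fA.
Qed.

(** The terms that do not vanish are those of the permutations [s] such that [T]
    maps the vertex [s i] of [x] to the vertex [i], for all [i]. There is one if
    [T] permutes the vertices of [x], the inverse of the permutation of the
    indices induced by [T], and none otherwise. *)
Lemma sum_sign_operm (R : nzRingType) (T : [subg graph_aut G]) x :
  \sum_(s : 'S_k.+1) (-1) ^+ s * (operm s (oaut T x) == x)%:R =
  (if sgval T @: vertices x == vertices x
   then (-1) ^+ restr_perm (vertices x) (sgval T) else 0 : R).
Proof.
have operm_oautP s : reflect (forall i, sgval T (val x i) = val x (s^-1%g i))
    (operm s (oaut T x) == x).
  apply: (iffP eqP) => [xE i|Tx].
    by rewrite -[in RHS]xE /= !ffunE permKV.
  by apply/val_inj/ffunP => i /=; rewrite !ffunE Tx permK.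
case: ifPn => [/eqP TA|TA]; last first.
  rewrite big1 // => s _; case: operm_oautP => [Tx|]; last by rewrite mulr0.
  case/negP: TA; rewrite eqEcard card_imset; last exact: perm_inj.
  rewrite leqnn andbT; apply/subsetP => _ /imsetP[_ /imsetP[i _ ->] ->].
  by rewrite Tx imset_f.
have /fin_all_exists[f fE] i : exists j, sgval T (val x i) = val x j.
  have : sgval T (val x i) \in vertices x by rewrite -TA !imset_f.
  by case/imsetP => j _ ->; exists j.
have f_inj : injective f.
  by move=> i j /(congr1 (val x)); rewrite -!fE => /perm_inj/osimplex_inj.
pose s0 := perm f_inj; have s0E i : sgval T (val x i) = val x (s0 i).
  by rewrite permE fE.
rewrite (bigD1 s0^-1%g) //= big1 ?addr0 => [|s ne_s]; last first.
  case: operm_oautP => [Tx|]; last by rewrite mulr0.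
  case/eqP: ne_s; rewrite -[s]invgK; congr (_^-1)%g; apply/permP => i.
  by apply: (@osimplex_inj _ _ x); rewrite -Tx s0E.
case: operm_oautP => [_|[]]; last by move=> i; rewrite invgK.
rewrite mulr1 odd_permV; congr (_ ^+ nat_of_bool _).
have TN : sgval T \in 'N(vertices x | 'P)%g.
  apply/astabsP => v.
  by rewrite /= /aperm -{1}TA mem_imset //; apply: perm_inj.
apply/esym/(odd_perm_transport (@osimplex_inj _ _ x)) => [i|v vx].
  by rewrite restr_permE ?s0E ?imset_f.
apply: (out_perm (restr_perm_on _ _)); apply/negP => /imsetP[i _ vE].
by have := vx i; rewrite vE eqxx.
Qed.
End OrderedSimplex.

Section TraceOnForms.
Variables (R : realType) (G : sgraph) (T : [subg graph_aut G]) (k : nat).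

(** The projection of the cochains onto the antisymmetric ones. *)
Definition antisymmetrize (f : cochain R G k) : cochain R G k :=
  [ffun x => k.+1`!%:R^-1 * \sum_(s : 'S_k.+1) (-1) ^+ s * f (operm s x)].
Fact antisymmetrize_is_linear : linear antisymmetrize.
Proof.
move=> a f g; apply/ffunP => x; rewrite !ffunE.
rewrite -[a *: (_ * _)]/(a * (_ * _)) mulrCA -mulrDr; congr (_ * _).
rewrite big_distrr -big_split /=; apply: eq_bigr => s _.
by rewrite !ffunE mulrDr [a * _]mulrCA.
Qed.
HB.instance Definition _ := GRing.isLinear.Build R (cochain R G k)
  (cochain R G k) _ antisymmetrize antisymmetrize_is_linear.

Lemma antisymmetrize_forms f : antisymmetrize f \in forms R G k.
Proof.
apply/formsP => t x; rewrite !ffunE mulrCA; congr (_ * _).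
rewrite big_distrr [RHS](reindex_inj (mulIg t)) /=; apply: eq_bigr => s _.
rewrite operm_comp mulrA; congr (_ * _).
by rewrite odd_permM -signr_addb addbC addbK.
Qed.

Lemma antisymmetrize_id f : f \in forms R G k -> antisymmetrize f = f.
Proof.
move=> /formsP fP; apply/ffunP => x; rewrite !ffunE.
under eq_bigr => s _ do rewrite fP mulrA -signr_addb addbb mul1r.
rewrite sumr_const card_Sn -[f x *+ _]mulr_natl mulrA mulVf ?mul1r //.
by rewrite pnatr_eq0 -lt0n fact_gt0.
Qed.

(** The diagonal coefficients of the pull-back of the antisymmetrization only
    depend on the underlying simplex. *)
Lemma trace_on_forms_fixed_simplices :
  trace_on (pullback R k T) (forms R G k) =
  \sum_(A : {set G} | [&& is_simplex A, #|A| == k.+1 & sgval T @: A == A])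
    (-1) ^+ restr_perm A (sgval T).
Proof.
rewrite (@trace_on_projection _ _ _ (linfun antisymmetrize)).
- rewrite lfun_trace_ffun.
  pose F (A : {set G}) : R :=
    if sgval T @: A == A then (-1) ^+ restr_perm A (sgval T) else 0.
  transitivity (\sum_(x : osimplex G k) k.+1`!%:R^-1 * F (vertices x)).
    apply: eq_bigr => x _; rewrite comp_lfunE pullbackE lfunE /= ffunE.
    rewrite /F -sum_sign_operm; congr (_ * _); apply: eq_bigr => s _.
    by rewrite ffunE; case: eqP.
  rewrite (partition_big (@vertices G k)
    (fun A => is_simplex A && (#|A| == k.+1))) /=; last first.
    by move=> x _; rewrite is_simplex_vertices card_vertices eqxx.
  under [RHS]eq_bigl do rewrite andbA; rewrite [RHS]big_mkcondr /=.
  apply: eq_bigr => A /andP[sA /eqP cA].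
  under eq_bigr => x /eqP -> do [].
  rewrite -big_distrr /= sumr_const.
  rewrite (_ : #|_| = k.+1`!); last by rewrite -(card_orderings sA cA) cardsE.
  rewrite -[F A *+ _]mulr_natl mulrA mulVf ?mul1r //.
  by rewrite pnatr_eq0 -lt0n fact_gt0.
- by move=> f; apply: pullback_forms.
- by move=> f; rewrite lfunE; apply: antisymmetrize_forms.
by move=> f fP; rewrite lfunE /= antisymmetrize_id.
Qed.
End TraceOnForms.

(** The Lefschetz number counts the fixed simplices, with the sign of the
    dimension and that of the permutation of the vertices. *)
Lemma lefschetz_fixed_simplices (R : realType) (G : sgraph)
    (T : [subg graph_aut G]) :
  lefschetz R T =
    \sum_(A : {set G} | is_simplex A && (sgval T @: A == A))
      (-1) ^+ odd_dim A * (-1) ^+ restr_perm A (sgval T).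
Proof.
rewrite hopf_trace_formula.
under eq_bigr => k _ do
  rewrite trace_on_forms_fixed_simplices big_distrr big_mkcond /=.
rewrite exchange_big [RHS]big_mkcond; apply: eq_bigr => A _ /=.
case: (boolP (is_simplex A)) => [sA|_] /=; last by rewrite big1.
case: ifP => TA; last by rewrite big1 // => k _; rewrite andbF.
have A_gt0 : (0 < #|A|)%N by rewrite card_gt0; case/andP: sA.
have ltA : (#|A|.-1 < #|G|)%N by rewrite prednK // max_card.
rewrite (bigD1 (Ordinal ltA)) //= prednK // eqxx /=.
rewrite big1 ?addr0 ?signr_odd // => k ne_k; case: ifP => // /andP[/eqP cA _].
by case/eqP: ne_k; apply/val_inj; rewrite /= cA.
Qed.

(** * Logarithmic derivatives of formal power series *)

Section FpsLogDeriv.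
Variable R : numFieldType.
Implicit Types f g h : fps R.

(** The coefficient of degree [n], as an additive map. *)
Definition coefps n f : R := fps_coef f n.
Fact coefps_is_additive n : zmod_morphism (coefps n).
Proof. by []. Qed.
HB.instance Definition _ n := GRing.isZmodMorphism.Build (fps R) R (coefps n)
  (coefps_is_additive n).

(** The formal derivative. *)
Definition fps_deriv f : fps R := Fps (fun n => n.+1%:R * fps_coef f n.+1).

Lemma coef_fpsM f g n :
  fps_coef (f * g) n = \sum_(i < n.+1) fps_coef f i * fps_coef g (n - i).
Proof. by []. Qed.

Lemma fps_deriv1 : fps_deriv 1 = 0.
Proof. by apply/fpsP => n; rewrite /= coef1 mulr0. Qed.

Lemma fps_derivM f g : fps_deriv (f * g) = fps_deriv f * g + f * fps_deriv g.
Proof.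
apply/fpsP => n.
(* up to degree [n.+1] the series can be replaced by polynomials *)
have tr m (u : fps R) i : (i < m)%N -> (fps_trunc m u)`_i = fps_coef u i.
  by move=> im; rewrite coef_fps_trunc im.
transitivity ((fps_trunc n.+2 f * fps_trunc n.+2 g)^`()`_n).
  by rewrite coef_deriv -mulr_natl -(@fps_mulE _ f g).
rewrite derivM coefD !coefM /=; congr (_ + _); apply: eq_bigr => i _;
  rewrite !coef_deriv !tr ?mulr_natl // ?ltnS ?leq_ord //.
- by rewrite ltnW // ltnS leq_subr.
- by rewrite leq_subr.
by rewrite ltnW // ltnS leq_ord.
Qed.

Lemma fps_derivX f k : fps_deriv (f ^+ k.+1) = (fps_deriv f * f ^+ k) *+ k.+1.
Proof.
elim: k => [|k IH]; first by rewrite expr1 expr0 mulr1.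
rewrite exprS fps_derivM {}IH [RHS]mulrS; congr (_ + _).
by rewrite mulrnAr mulrCA -exprS.
Qed.

(** [h] is the logarithmic derivative of [f], a series with constant term 1. *)
Definition has_log_deriv f h := fps_coef f 0%N = 1 /\ fps_deriv f = h * f.

(** A series with constant term 1 is determined by its logarithmic derivative:
    the equation [f' = h * f] computes its coefficients one after the other. *)
Lemma log_deriv_inj f g h : has_log_deriv f h -> has_log_deriv g h -> f = g.
Proof.
move=> [f0 Df] [g0 Dg]; apply/fpsP => n.
elim/ltn_ind: n => -[_|n IH]; first by rewrite f0 g0.
have n1_neq0 : n.+1%:R != 0 :> R by rewrite pnatr_eq0.
apply: (mulfI n1_neq0).
rewrite -[LHS]/(fps_coef (fps_deriv f) n) -[RHS]/(fps_coef (fps_deriv g) n).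
rewrite Df Dg /=; apply: eq_bigr => i _; congr (_ * _).
by apply: IH; rewrite ltnS leq_subr.
Qed.

Lemma has_log_deriv1 : has_log_deriv 1 0.
Proof. by split; rewrite ?fps_deriv1 ?mul0r //= coef1. Qed.

Lemma has_log_derivM f f' g g' :
  has_log_deriv f f' -> has_log_deriv g g' -> has_log_deriv (f * g) (f' + g').
Proof.
move=> [f0 Df] [g0 Dg]; split; first by rewrite /= big_ord1 f0 g0 mulr1.
by rewrite fps_derivM Df Dg mulrDl -mulrA [g' * (f * _)]mulrCA.
Qed.

Lemma has_log_derivV f f' : has_log_deriv f f' -> has_log_deriv f^-1 (- f').
Proof.
move=> [f0 Df].
have uf : f \is a GRing.unit.
  by rewrite -[_ \is a _]/(fps_coef f 0%N \is a GRing.unit) f0 unitr1.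
have := mulVr uf => fV; split.
  have := congr1 (coefps 0) fV.
  by rewrite /coefps /= big_ord1 f0 mulr1 coef1.
have := congr1 fps_deriv fV; rewrite fps_deriv1 fps_derivM Df => /eqP.
rewrite addr_eq0 [f^-1 * _]mulrCA fV mulr1 => /eqP e.
by rewrite -[LHS]mulr1 -(mulrV uf) mulrA e mulNr.
Qed.

Lemma has_log_derivXn f f' n :
  has_log_deriv f f' -> has_log_deriv (f ^+ n) (f' *+ n).
Proof.
move=> ff'; elim: n => [|n IH]; first exact: has_log_deriv1.
by rewrite exprS mulrS; apply: has_log_derivM.
Qed.

Lemma has_log_derivXz f f' (z : int) :
  has_log_deriv f f' -> has_log_deriv (f ^ z) (f' *~ z).
Proof.
move=> ff'; case: z => n; first exact: has_log_derivXn.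
exact: has_log_derivV (has_log_derivXn n.+1 ff').
Qed.

Lemma has_log_deriv_prod (I : Type) (r : seq I) (P : pred I)
    (F F' : I -> fps R) :
    (forall i, P i -> has_log_deriv (F i) (F' i)) ->
  has_log_deriv (\prod_(i <- r | P i) F i) (\sum_(i <- r | P i) F' i).
Proof.
move=> FF'; elim/big_rec2: _ => [|i f g Pi fg]; first exact: has_log_deriv1.
by apply: has_log_derivM => //; apply: FF'.
Qed.

Lemma coef_fpsX_small f k n :
  fps_coef f 0%N = 0 -> (n < k)%N -> fps_coef (f ^+ k) n = 0.
Proof.
move=> f0; elim: k n => // k IH n nk; rewrite exprS /= big_ord_recl f0 mul0r.
rewrite add0r big1 // => i _; rewrite IH ?mulr0 // /= /bump.
by case: n nk i => [_ []|n nk i] //; lia.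
Qed.

Lemma has_log_deriv_exp f :
  fps_coef f 0%N = 0 -> has_log_deriv (fps_exp f) (fps_deriv f).
Proof.
move=> f0; split; first by rewrite /= big_ord1 expr0 /= coef1 fact0 divr1.
(* the terms with [k > n] have a vanishing coefficient in degree [n] *)
have expE m n : (n < m)%N ->
    fps_coef (fps_exp f) n = \sum_(k < m) fps_coef (f ^+ k) n / k`!%:R.
  move=> nm.
  rewrite /= (big_ord_widen m (fun k => fps_coef (f ^+ k) n / k`!%:R)) //.
  rewrite big_mkcond; apply: eq_bigr => k _; case: ifPn => //.
  by rewrite -leqNgt => nk; rewrite coef_fpsX_small // mul0r.
(* the derivative of [f ^ k.+1 / k.+1!] is [f' * f ^ k / k!] *)
apply/fpsP => n; rewrite coef_fpsM.
rewrite [LHS]/= big_ord_recl expr0 /= coef1 mul0r add0r big_distrr /=.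
transitivity (\sum_(k < n.+1) fps_coef (fps_deriv f * f ^+ k) n / k`!%:R).
  apply: eq_bigr => k _; rewrite /bump add1n mulrA.
  rewrite -[_ * fps_coef _ _]/(coefps n (fps_deriv (f ^+ k.+1))).
  rewrite fps_derivX raddfMn /= factS natrM invfM mulrA; congr (_ / _).
  by rewrite -[X in X / _]mulr_natr mulfK // pnatr_eq0.
transitivity (\sum_(k < n.+1) \sum_(i < n.+1)
    fps_coef (fps_deriv f) i * fps_coef (f ^+ k) (n - i) / k`!%:R).
  by apply: eq_bigr => k _; rewrite -big_distrl.
rewrite exchange_big /=; apply: eq_bigr => i _.
rewrite -[X in _ = _ * X]/(fps_coef (fps_exp f) (n - i)).
rewrite (expE n.+1) ?ltnS ?leq_subr // big_distrr /=.
by apply: eq_bigr => k _; rewrite mulrA.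
Qed.

(** [- \sum_(m > 0) p * c ^ m * 'X^(p * m - 1)], the logarithmic derivative of
    [1 - c *: 'X^p]. *)
Definition log_deriv_binomial p (c : R) : fps R :=
  Fps (fun n => if (p %| n.+1)%N then - p%:R * c ^+ (n.+1 %/ p) else 0).

Lemma has_log_deriv_binomial p c : (0 < p)%N ->
  has_log_deriv (fps_of_poly (1 - c *: 'X^p)) (log_deriv_binomial p c).
Proof.
move=> p_gt0; have coefE i : (1 - c *: 'X^p)`_i = (i == 0)%:R - c * (i == p)%:R.
  by rewrite coefB coef1 coefZ coefXn.
split; first by rewrite /= coefE eqxx eq_sym (gtn_eqF p_gt0) mulr0 subr0.
apply/fpsP => n; rewrite mulrC.
have -> : fps_coef (fps_of_poly (1 - c *: 'X^p) * log_deriv_binomial p c) n =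
    fps_coef (log_deriv_binomial p c) n -
    c * (if (p < n.+1)%N then fps_coef (log_deriv_binomial p c) (n - p) else 0).
  rewrite -[LHS]/(\sum_(i < n.+1) (1 - c *: 'X^p)`_i * fps_coef _ (n - i)).
  under eq_bigr => i _ do rewrite coefE mulrBl.
  rewrite sumrB; congr (_ - _).
    rewrite big_ord_recl /= mul1r subn0 big1 ?addr0 // => i _.
    by rewrite mul0r.
  rewrite -(big_ord1_eq +%R
    (fun i => fps_coef (log_deriv_binomial p c) (n - i)%N)).
  rewrite [in RHS]big_mkcond [RHS]big_distrr; apply: eq_bigr => i _ /=.
  by case: eqP => _; rewrite ?mulr1 ?mulr0 ?mul0r.
rewrite /= coefE sub0r mulrN ltnS.
(* the terms [- p * c ^ m] cancel in the product by [1 - c *: 'X^p], except for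
   the first one, in degree [p - 1] *)
have [np|pn|np] := ltngtP n.+1 p.
- rewrite leqNgt ltnW // mulr0 subr0 mulr0 oppr0.
  by case: ifP => // /(dvdn_leq (ltn0Sn n)); rewrite leqNgt np.
- have -> : n.+1 = ((n - p).+1 + p)%N by lia.
  rewrite dvdn_addl // !mulr0 oppr0 (_ : (p <= n)%N) //.
  case: ifP => [pd|]; last by rewrite mulr0 subr0.
  by rewrite divnDr // divnn p_gt0 addn1 exprS; ring.
by rewrite np dvdnn divnn p_gt0 (_ : (p <= n)%N = false) /=; [ring | lia].
Qed.

End FpsLogDeriv.

(** * Prime periodic orbits *)

(** The iterates of an injective map fixing a point are those whose exponent is
    divisible by the size of its orbit. *)
Lemma iter_eq_order_dvdn (X : finType) (f : X -> X) (x : X) n :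
  injective f -> (iter n f x == x) = (fingraph.order f x %| n)%N.
Proof.
move=> f_inj; have iterM m : iter (m * fingraph.order f x) f x = x.
  by elim: m => // m IH; rewrite mulSn iterD IH iter_order.
rewrite {1}(divn_eq n (fingraph.order f x)) addnC iterD iterM /dvdn.
have lt_mod := ltn_pmod n (fingraph.order_gt0 f x).
apply/eqP/eqP => [fx|->] //.
by rewrite -(findex_iter lt_mod) fx findex0.
Qed.

Section PrimePeriods.
Variables (G : sgraph) (T : [subg graph_aut G]).
Implicit Types (x : {set G}) (P : pred {set G}).

(* the iterates of [T] on the simplices are those of a self-map of the finite
   set of subsets of the vertices *)
Let F x : {set G} := sgval T @: x.

Let F_inj : injective F.
Proof. exact/imset_inj/perm_inj. Qed.

Lemma simplex_iterE n x : simplex_iter T n x = iter n F x.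
Proof.
elim: n x => [|n IH] x.
  rewrite /simplex_iter expg0 -[RHS]imset_id.
  by apply: eq_imset => v; rewrite perm1.
rewrite iterS -IH /F /simplex_iter -imset_comp expgSr.
by apply: eq_imset => v; rewrite permM.
Qed.

Lemma simplex_orbit_order x :
  simplex_orbit T (fingraph.order F x) x = [set y | fconnect F x y].
Proof.
apply/setP => y; rewrite inE; apply/imsetP/idP => [[i _ ->]|xy].
  by rewrite simplex_iterE fconnect_iter.
exists (Ordinal (findex_max xy)) => //.
by rewrite simplex_iterE /= iter_findex.
Qed.

(** The minimal period is the size of the orbit of the simplex. *)
Lemma has_prime_period_order p x : (0 < p)%N ->
  has_prime_period T p x = is_simplex x && (fingraph.order F x == p).
Proof.
move=> p_gt0; rewrite /has_prime_period; congr (_ && _).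
apply/andP/eqP => [[/eqP card_p]|<-].
  rewrite simplex_iterE (iter_eq_order_dvdn _ _ F_inj) => /dvdn_leq lep.
  rewrite -card_p; apply/esym/eq_card => y; rewrite -topredE /=.
  apply/imsetP/idP => [[i _ ->]|xy].
    by rewrite simplex_iterE; apply: fconnect_iter.
  have lt_p := leq_trans (findex_max xy) (lep p_gt0).
  by exists (Ordinal lt_p); rewrite // simplex_iterE iter_findex.
by rewrite simplex_iterE iter_order // simplex_orbit_order cardsE.
Qed.

Lemma is_simplex_aut x : is_simplex x -> is_simplex (F x).
Proof.
move=> /andP[x_n0 /forallP xadj]; apply/andP; split.
  by rewrite -card_gt0 card_imset ?card_gt0 //; apply: perm_inj.
apply/forallP => w; apply/implyP => /imsetP[u ux ->] {w}.
apply/forallP => w; apply/implyP => /imsetP[v vx ->]; apply/implyP => ne_uv.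
have /graph_autP -> := subgP T.
have /implyP/(_ ux)/forallP/(_ v)/implyP/(_ vx)/implyP := xadj u; apply.
by apply: contraNneq ne_uv => ->.
Qed.

Lemma order_aut x : fingraph.order F (F x) = fingraph.order F x.
Proof. by apply: eq_card => y; rewrite !inE; apply/esym/same_fconnect1. Qed.

Lemma has_prime_period_aut p x : (0 < p)%N ->
  has_prime_period T p x -> has_prime_period T p (F x).
Proof.
move=> p_gt0; rewrite !has_prime_period_order // order_aut.
by case/andP => /is_simplex_aut ->.
Qed.

(** A property invariant along the orbits holds for [p] times as many simplices
    as there are orbits of length [p] with this property. *)
Lemma card_prime_period p P : (0 < p)%N ->
    (forall x, has_prime_period T p x -> P (F x) = P x) ->
  #|[set x | has_prime_period T p x && P x]| = (p * num_orbits T p P)%N.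
Proof.
move=> p_gt0 PF; rewrite -sum1_card.
rewrite (partition_big_imset (simplex_orbit T p)) /= mulnC.
rewrite /num_orbits -sum_nat_const; apply: eq_big => // _ /imsetP[x xS ->].
have /andP[xp Px] : has_prime_period T p x && P x by move: xS; rewrite inE.
have /andP[sx /eqP ordx] : is_simplex x && (fingraph.order F x == p).
  by rewrite -has_prime_period_order.
rewrite sum1_card -[RHS]ordx; apply: eq_card => y.
rewrite -!topredE /= inE.  apply/idP/idP => [/andP[/andP[yp _] /eqP Oy]|xy].
  have : y \in simplex_orbit T p y.
    apply/imsetP; exists (Ordinal p_gt0) => //.
    by rewrite simplex_iterE.
  by rewrite Oy -ordx simplex_orbit_order inE.
have yE := iter_findex xy; have : has_prime_period T p y && P y.
  rewrite -yE; elim: (findex F x y) => [|n /andP[np nP]] /=.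
    by rewrite xp.
  by rewrite has_prime_period_aut //= PF.
move=> ySP; rewrite ySP; apply/eqP.
have /andP[_ /eqP ordy] : is_simplex y && (fingraph.order F y == p).
  by rewrite -has_prime_period_order //; case/andP: ySP.
rewrite -[in LHS]ordy -ordx !simplex_orbit_order; apply/setP => z.
by rewrite !inE -(same_connect (fconnect_sym F_inj) xy).
Qed.

Lemma prime_period_normal p x :
  has_prime_period T p x -> (sgval T ^+ p)%g \in 'N(x | 'P)%g.
Proof.
case/and3P => _ _ /eqP Tx; apply/astabsP => v.
by rewrite /= /aperm -{1}Tx mem_imset //; apply: perm_inj.
Qed.

(** The signature of [T ^ p] on a simplex of period [p] is constant along the
    orbit: [T] conjugates the permutations of the vertices. *)
Lemma negative_sign_aut p x : (0 < p)%N -> has_prime_period T p x ->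
  negative_sign T p (F x) = negative_sign T p x.
Proof.
move=> p_gt0 xp; have xN := prime_period_normal xp.
have FxN := prime_period_normal (has_prime_period_aut p_gt0 xp).
apply: (odd_perm_transport (@perm_inj _ (sgval T))) => [u|v vT]; last first.
  by have := vT ((sgval T)^-1%g v); rewrite permKV eqxx.
have [ux|ux] := boolP (u \in x).
  by rewrite !restr_permE ?imset_f // -!permM (commuteX p (commute_refl _)).
rewrite !(out_perm (restr_perm_on _ _)) ?mem_imset //; exact: perm_inj.
Qed.

(** The signature of [T ^ (p * m)] is the power of exponent [m] of that of
    [T ^ p]. *)
Lemma odd_restr_permX p m x : has_prime_period T p x ->
  odd_perm (restr_perm x (sgval T ^+ (p * m))%g) =
    negative_sign T p x && odd m.
Proof.
move=> xp; rewrite expgM morphX ?(prime_period_normal xp) //= /negative_sign.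
elim: m => [|m IH]; rewrite ?expg0 ?odd_perm1 ?andbF // expgS odd_permM IH /=.
by case: odd_perm; case: odd.
Qed.

Lemma odd_dim_aut x : odd_dim (F x) = odd_dim x.
Proof. by rewrite /odd_dim card_imset //; apply: perm_inj. Qed.

Lemma sgvalX n : sgval (T ^+ n)%g = (sgval T ^+ n)%g.
Proof. by rewrite (morphX [morphism of sgval]) ?inE. Qed.

(** The Lefschetz number of an iterate, in terms of the prime periodic orbits;
    [N] exceeds all the minimal periods, which are orbit sizes. *)
Lemma lefschetz_iterate (R : realType) n N :
  (#|{set G}| < N)%N ->
  lefschetz R (T ^+ n.+1)%g =
  \sum_(1 <= p < N | (p %| n.+1)%N)
    - p%:R * (((orbits_a T p)%:R - (orbits_b T p)%:R) +
      ((orbits_c T p)%:R - (orbits_d T p)%:R) * (-1) ^+ (n.+1 %/ p)).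
Proof.
move=> leN; rewrite lefschetz_fixed_simplices.
(* the contribution of a simplex [x] of period [p] dividing [n.+1] *)
pose w p x : R :=
  (-1) ^+ odd_dim x * (-1) ^+ (negative_sign T p x && odd (n.+1 %/ p)).
transitivity (\sum_x \sum_(1 <= p < N | (p %| n.+1)%N)
    if has_prime_period T p x then w p x else 0).
  rewrite big_mkcond; apply: eq_bigr => x _.
  rewrite sgvalX -/(simplex_iter T n.+1 x) simplex_iterE.
  rewrite iter_eq_order_dvdn; last exact: F_inj.
  set q := fingraph.order F x; have q_gt0 : (0 < q)%N := fingraph.order_gt0 F x.
  have qN : (q < N)%N by apply: leq_ltn_trans leN; apply: max_card.
  rewrite big_nat_cond.
  under [RHS]eq_bigr => p /andP[/andP[p_gt0 _] _] do
    rewrite has_prime_period_order // -/q.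
  rewrite -big_nat_cond.
  case: ifPn => [/andP[sx qn]|nx]; last first.
    rewrite big1 // => p pn; case: ifP => // /andP[sx /eqP qp].
    by case/negP: nx; rewrite sx qp.
  rewrite sx /= -big_mkcondr /=.
  under eq_bigl => p do rewrite [q == p]eq_sym.
  rewrite big_nat1_cond_eq q_gt0 qN qn /w.
  rewrite -odd_restr_permX ?has_prime_period_order ?sx -/q ?eqxx //.
  by rewrite mulnC divnK.
rewrite exchange_big /= big_nat_cond [RHS]big_nat_cond.
apply: eq_bigr => p /andP[/andP[p_gt0 _] pn].
have card_P P : (forall x, has_prime_period T p x -> P (F x) = P x) ->
    \sum_x (has_prime_period T p x && P x)%:R =
      p%:R * (num_orbits T p P)%:R :> R.
  move=> PF; rewrite -natrM -card_prime_period // -sum1_card natr_sum.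
  rewrite [RHS]big_mkcond; apply: eq_bigr => x _.
  by rewrite inE; case: ifP.
(* split the simplices according to the parity of the dimension and the sign *)
pose m := (-1) ^+ (n.+1 %/ p) : R.
pose cnt P x : R := (has_prime_period T p x && P x)%:R.
transitivity (\sum_x
  (- cnt [pred y | odd_dim y && ~~ negative_sign T p y] x
   + cnt [pred y | ~~ odd_dim y && ~~ negative_sign T p y] x
   - cnt [pred y | odd_dim y && negative_sign T p y] x * m
   + cnt [pred y | ~~ odd_dim y && negative_sign T p y] x * m)).
  apply: eq_bigr => x _; rewrite /w /m /cnt /= -[in RHS]signr_odd.
  case: has_prime_period => /=; last by ring.
  by case: odd_dim; case: negative_sign; rewrite /= ?expr0 ?expr1; ring.
rewrite !big_split /= !sumrN -!big_distrl /=.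
rewrite /cnt !card_P.
  by rewrite /m /orbits_a /orbits_b /orbits_c /orbits_d; ring.
all: by move=> x xp /=; rewrite odd_dim_aut negative_sign_aut.
Qed.
End PrimePeriods.

(** * The zeta function *)

(* The factors of the infinite product are eventually 1, so that its partial
   products are eventually constant. *)
Theorem theorem6p2 (R : realType) (G : sgraph) (T : [subg graph_aut G]) :
  exists N0 : nat, forall N : nat, (N0 <= N)%N ->
    zeta R T =
      \prod_(1 <= p < N)
        (fps_of_poly (1 - 'X^p) ^ ((orbits_a T p)%:Z - (orbits_b T p)%:Z) *
         fps_of_poly (1 + 'X^p) ^ ((orbits_c T p)%:Z - (orbits_d T p)%:Z)).
Proof.
exists #|{set G}|.+1 => N leN.
pose l : fps R := Fps (fun n =>
  if n is 0 then 0 else lefschetz R (T ^+ n)%g / n%:R).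
apply: (@log_deriv_inj _ _ _ (fps_deriv l)); first exact: has_log_deriv_exp.
pose h p : fps R :=
  log_deriv_binomial p 1 *~ ((orbits_a T p)%:Z - (orbits_b T p)%:Z) +
  log_deriv_binomial p (-1) *~ ((orbits_c T p)%:Z - (orbits_d T p)%:Z).
(* [h p] is the logarithmic derivative of the factor of index [p] *)
have -> : fps_deriv l = \sum_(1 <= p < N) h p.
  apply/fpsP => n; rewrite -[RHS]/(coefps n _) raddf_sum /=.
  rewrite mulrC divfK ?pnatr_eq0 // (lefschetz_iterate _ _ _ leN) big_mkcond.
  apply: eq_bigr => p _; rewrite -!/(coefps n _) !raddfMz /coefps /=.
  have mulz (y : R) (i j : nat) : y *~ (i%:Z - j%:Z) = y * (i%:R - j%:R).
    by rewrite -[LHS]mulrzr rmorphB.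
  rewrite !mulz expr1n; case: ifP => _; last by rewrite !mul0r addr0.
  by ring.
rewrite [X in has_log_deriv X _]big_nat_cond.
rewrite [X in has_log_deriv _ X]big_nat_cond.
apply: has_log_deriv_prod => p /andP[/andP[p_gt0 _] _].
apply: has_log_derivM; apply: has_log_derivXz.
  by have := has_log_deriv_binomial (1 : R) p_gt0; rewrite scale1r.
by have := has_log_deriv_binomial (-1 : R) p_gt0; rewrite scaleN1r opprK.
Qed.
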